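(* Let $R$ be a ring and $M$ a left $R$-module. Then there are an injective left $R$-module $I$ and a split monomorphism $\sigma:I\to I$ such that $$M\cong\varprojlim\bigl(I\xleftarrow{\sigma}I\xleftarrow{\sigma}I\xleftarrow{\sigma}\cdots\bigr)\cong\bigcap_{n<\omega}\sigma^n(I)$$ as left $R$-modules.
   Context: Rings are unital and associative, but not necessarily commutative; all modules are unital left modules. $\omega$ denotes the first infinite ordinal. A split monomorphism is an $R$-linear map having an $R$-linear left inverse. The inverse limit is over the $\omega$-indexed tower all of whose terms are $I$ and all of whose successive connecting maps are $\sigma$; $\sigma^n$ is the $n$-fold composite of $\sigma$ with itself. *)

(* Defs.v *)
From HB Require Import structures.
From mathcomp Require Import all_boot all_algebra.
From mathcomp Require Import boolp classical_sets functions.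

Set Implicit Arguments.
Unset Strict Implicit.
Unset Printing Implicit Defensive.

Import GRing.Theory.
Local Open Scope ring_scope.
Local Open Scope classical_set_scope.

(* Rings are [pzRingType]s, so that the zero ring is allowed. *)

Definition injective_module (R : pzRingType) (I : lmodType R) : Prop :=
  forall (A B : lmodType R) (i : {linear A -> B}) (g : {linear A -> I}),
    injective i -> exists h : {linear B -> I}, forall a, h (i a) = g a.

Definition split_mono (R : pzRingType) (U V : lmodType R)
    (f : {linear U -> V}) : Prop :=
  exists g : {linear V -> U}, cancel f g.

Definition lmod_iso (R : pzRingType) (U V : lmodType R) : Prop :=
  exists f : {linear U -> V}, bijective f.

Section TowerLimit.
Variables (R : pzRingType) (X : nat -> lmodType R).
Variable f : forall n, {linear X n.+1 -> X n}.

(* The inverse limit of X 0 <- X 1 <- X 2 <- ..., realized as the module of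
   compatible threads in the product of the X n. *)
Record tower_lim : Type := TowerLim {
  thread :> forall n, X n;
  threadP : forall n, f n (thread n.+1) = thread n }.

HB.instance Definition _ := gen_eqMixin tower_lim.
HB.instance Definition _ := gen_choiceMixin tower_lim.

Lemma tower_lim_ext (x y : tower_lim) : (forall n, x n = y n) -> x = y.
Proof.
case: x y => [x xP] [y yP] /= xy.
have {}xy : x = y by apply: functional_extensionality_dep.
by subst y; congr TowerLim; apply: Prop_irrelevance.
Qed.

Definition tower_zero : tower_lim.
Proof. by exists (fun n => 0) => n; rewrite linear0. Defined.

Definition tower_opp (x : tower_lim) : tower_lim.
Proof. by exists (fun n => - x n) => n; rewrite linearN threadP. Defined.

Definition tower_add (x y : tower_lim) : tower_lim.
Proof. by exists (fun n => x n + y n) => n; rewrite linearD !threadP. Defined.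

Definition tower_scale (a : R) (x : tower_lim) : tower_lim.
Proof. by exists (fun n => a *: x n) => n; rewrite linearZ /= threadP. Defined.

Fact tower_addA : associative tower_add.
Proof. by move=> x y z; apply: tower_lim_ext => n; apply: addrA. Qed.

Fact tower_addC : commutative tower_add.
Proof. by move=> x y; apply: tower_lim_ext => n; apply: addrC. Qed.

Fact tower_add0 : left_id tower_zero tower_add.
Proof. by move=> x; apply: tower_lim_ext => n; apply: add0r. Qed.

Fact tower_addN : left_inverse tower_zero tower_opp tower_add.
Proof. by move=> x; apply: tower_lim_ext => n; apply: addNr. Qed.

HB.instance Definition _ := GRing.isZmodule.Build tower_lim
  tower_addA tower_addC tower_add0 tower_addN.

Fact tower_scaleA a b (x : tower_lim) :
  tower_scale a (tower_scale b x) = tower_scale (a * b) x.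
Proof. by apply: tower_lim_ext => n; apply: scalerA. Qed.

Fact tower_scale1 : left_id 1 tower_scale.
Proof. by move=> x; apply: tower_lim_ext => n; apply: scale1r. Qed.

Fact tower_scaleDr : right_distributive tower_scale +%R.
Proof. by move=> a x y; apply: tower_lim_ext => n; apply: scalerDr. Qed.

Fact tower_scaleDl (x : tower_lim) :
  {morph tower_scale^~ x : a b / a + b >-> a + b}.
Proof. by move=> a b; apply: tower_lim_ext => n; apply: scalerDl. Qed.

HB.instance Definition _ := GRing.Zmodule_isLmodule.Build R tower_lim
  tower_scaleA tower_scale1 tower_scaleDr tower_scaleDl.

End TowerLimit.

Arguments tower_lim {R} X f.

Section IterImage.
Variables (R : pzRingType) (I : lmodType R) (sigma : {linear I -> I}).

Definition iter_image_cap : set I :=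
  \bigcap_(n in [set: nat]) range (iter n sigma).

Definition iter_image_cap_pred : {pred I} := fun x => x \in iter_image_cap.

Fact iter_image_cap_submod_closed : submod_closed iter_image_cap_pred.
Proof.
have itL n a x y : iter n sigma (a *: x + y) = a *: iter n sigma x + iter n sigma y.
  by elim: n => //= n ->; rewrite linearP.
have it0 n : iter n sigma 0 = 0 by elim: n => //= n ->; rewrite linear0.
split; first by apply/mem_set => n _; exists 0.
move=> a x y /set_mem Sx /set_mem Sy; apply/mem_set => n _.
have [u _ <-] := Sx n Logic.I; have [v _ <-] := Sy n Logic.I.
by exists (a *: u + v).
Qed.

HB.instance Definition _ := GRing.isSubmodClosed.Build R I iter_image_cap_pred
  iter_image_cap_submod_closed.

(* The intersection of the images of the iterates of sigma, as a submodule. *)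
Record iter_cap : Type := IterCap {
  iter_cap_val :> I;
  iter_cap_valP : iter_cap_val \in iter_image_cap_pred }.

HB.instance Definition _ := [isSub for iter_cap_val].
HB.instance Definition _ := [Choice of iter_cap by <:].
HB.instance Definition _ := [SubChoice_isSubLmodule of iter_cap by <:].

End IterImage.

(* Main.v *)
Require Import Defs.
From HB Require Import structures.
From mathcomp Require Import all_boot all_order all_algebra.
From mathcomp Require Import boolp classical_sets functions.

(** Embed M in an injective module I0 with an injective module J receiving a
    map f : I0 -> J whose kernel is M.  Let S be the direct sum of countably many
    copies of J.  If S were injective, the endomorphism
      (x, s) |-> (x, (f x, s_0, s_1, ...))
    of I0 * S would do: a pair (x, s) in all the images of its iterates has
    s_i = f x for every i, and finite support forces f x = 0 and s = 0, so that
    the intersection of the images is M * 0.  But S need not be injective.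

    The remedy is to replace S by an injective module E in which S is essential
    (injective_hull).  The shift (j, s) |-> (j, s_0, s_1, ...) from J * S to S
    extends to tau : J * E -> E because E is injective, and tau is injective
    because J * S is essential in J * E.  The finite support argument survives
    (injective_shift): if (x, y) lies in all the images of
      sigma (x, y) = (x, tau (f x, y))
    and y <> 0, some multiple r y is a nonzero element s of S; injectivity of
    tau peels off one coordinate at a time and gives s_i = r f x for all i, so
    s = 0, a contradiction.  That sigma splits is automatic, being an injective
    map out of an injective module.

    The supply of injective modules is the classical one: divisible abelian
    groups are injective (divisible_injective), homomorphisms to Q/Z separate
    points from subgroups (rat_mod_int_cogenerates), and coinduction
    Hom_Z(R, -) carries injective abelian groups to injective R-modules
    (injective_coind).  Applying this to functionals that vanish on a submodule
    N yields a map to an injective module with kernel exactly N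
    (injective_with_kernel), so that no quotient module has to be formed.

    Partial linear maps are handled through their graphs, as submodules of a
    product; a single application of Zorn's lemma (max_submodule) serves
    everywhere. *)

Set Implicit Arguments.
Unset Strict Implicit.
Unset Printing Implicit Defensive.

Import Order.TTheory GRing.Theory Num.Theory.
Local Open Scope ring_scope.
Local Open Scope classical_set_scope.

(** * Submodules and maximal submodules *)

Definition to_linear (R : pzRingType) (U V : lmodType R) (f : U -> V)
    (f_lin : linear f) : {linear U -> V} :=
  HB.pack f (GRing.isLinear.Build R U V *:%R f f_lin).

Definition submodule (R : pzRingType) (V : lmodType R) (N : set V) : Prop :=
  N 0 /\ forall a x y, N x -> N y -> N (a *: x + y).

Section Submodules.
Variables (R : pzRingType) (V : lmodType R).
Implicit Types (N Q : set V).

Lemma submodule0 : submodule [set 0 : V].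
Proof. by split=> // a x y /= -> ->; rewrite scaler0 addr0. Qed.

Lemma submoduleD N x y : submodule N -> N x -> N y -> N (x + y).
Proof. by move=> [_ NP] Nx Ny; rewrite -[x]scale1r; apply: NP. Qed.

Lemma submoduleZ N a x : submodule N -> N x -> N (a *: x).
Proof. by move=> [N0 NP] Nx; rewrite -[_ *: _]addr0; apply: NP. Qed.

Lemma submoduleB N x y : submodule N -> N x -> N y -> N (x - y).
Proof. by move=> [_ NP] Nx Ny; rewrite addrC -scaleN1r; apply: NP. Qed.

Lemma submodule_add_line N v :
  submodule N -> submodule [set x + a *: v | x in N & a in [set: R]].
Proof.
move=> Nsub; split; first exists 0 => //.
- by case: Nsub.
- by exists 0; rewrite // scale0r addr0.
move=> a _ _ [x Nx [c _ <-]] [y Ny [d _ <-]].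
exists (a *: x + y); first by case: Nsub => _; apply.
by exists (a * c + d) => //; rewrite scalerDr scalerA scalerDl addrACA.
Qed.

(** Both being a submodule and being contained in Q pass to unions of chains.
    Maximality is recorded in the form in which it is applied: N absorbs every v
    for which N + R v stays in Q.  The properties Q of interest are essentiality,
    trivial intersection with a given submodule, and being the graph of a
    partial map. *)
Lemma max_submodule N0 Q : submodule N0 -> N0 `<=` Q ->
  exists N, [/\ submodule N, N0 `<=` N, N `<=` Q &
    forall v, (forall x a, N x -> Q (x + a *: v)) -> N v].
Proof.
move=> subN0 N0Q.
(* Zorn's lemma also sees the empty chain, whence the union with N0. *)
pose P := [set N | submodule (N0 `|` N) /\ N `<=` Q].
have [F FP Ftot|N [[subN NQ] Nmax]] := @Zorn_bigcup _ P.
  split; last by move=> x [N /FP[_ NQ]] /NQ.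
  split; first by left; case: subN0.
  have [[N FN]|F0] := pselect (exists N, F N); last first.
    move=> a x y [N0x|[N FN]]; last by case: F0; exists N.
    move=> [N0y|[N FN]]; last by case: F0; exists N.
    by left; case: subN0 => _; apply.
  have lift x : (N0 `|` \bigcup_(X in F) X) x -> exists2 X, F X & (N0 `|` X) x.
    by move=> [N0x|[X FX Xx]]; [exists N => //; left | exists X => //; right].
  move=> a x y /lift[X FX Xx] /lift[Y FY Yy].
  suff: exists2 Z, F Z & (N0 `|` Z) (a *: x + y).
    by move=> [Z FZ []]; [left | right; exists Z].
  have [XY|YX] := Ftot X Y FX FY.
    exists Y => //; have [_] := (FP _ FY).1; apply=> //.
    by case: Xx => [|/XY]; [left | right].
  exists X => //; have [_] := (FP _ FX).1; apply=> //.
  by case: Yy => [|/YX]; [left | right].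
exists (N0 `|` N); split=> //; first by move=> x [/N0Q|/NQ].
move=> v Qv; apply: contrapT => Nv.
pose N' := [set x + a *: v | x in N0 `|` N & a in [set: R]].
have NN' : N0 `|` N `<=` N'.
  by move=> x Nx; exists x => //; exists 0; rewrite // scale0r addr0.
have N'v : N' v by exists 0; [case: subN | exists 1; rewrite // scale1r add0r].
apply: (Nmax N').
  split; first by move=> x Nx; apply: NN'; right.
  by move=> /(_ _ N'v) ?; apply: Nv; right.
split; last by move=> _ [x Nx [a _ <-]]; apply: Qv.
suff -> : N0 `|` N' = N' by apply: submodule_add_line.
by apply/seteqP; split=> x; [move=> [N0x|//]; apply: NN'; left | right].
Qed.

End Submodules.

Section SubmoduleType.
Variables (R : pzRingType) (V : lmodType R) (N : set V) (subN : submodule N).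

Definition submod_pred of submodule N : {pred V} := fun x => x \in N.

Fact submod_pred_closed : submod_closed (submod_pred subN).
Proof.
case: (subN) => N0 NP; split; first exact/mem_set.
by move=> a x y /set_mem Nx /set_mem Ny; apply/mem_set/NP.
Qed.

HB.instance Definition _ := GRing.isSubmodClosed.Build R V (submod_pred subN)
  submod_pred_closed.

Record submod : Type := Submod {
  submod_val :> V;
  submod_valP : submod_val \in submod_pred subN }.

HB.instance Definition _ := [isSub for submod_val].
HB.instance Definition _ := [Choice of submod by <:].
HB.instance Definition _ := [SubChoice_isSubLmodule of submod by <:].

Definition to_submod x (Nx : N x) : submod :=
  Submod (mem_set Nx : x \in submod_pred subN).

Lemma submod_in (x : submod) : N x.
Proof. exact: set_mem (submod_valP x). Qed.

Lemma submod_inj : injective submod_val.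
Proof. exact: val_inj. Qed.

Lemma submod_linear : linear submod_val.
Proof. by []. Qed.

End SubmoduleType.

(** * Linear maps given by their graphs *)

Section Graphs.
Variables (R : pzRingType).
Implicit Types (A B I : lmodType R).

Lemma graph_uniq B I (G : set (B * I)%type) b c d : submodule G ->
  (forall d, G (0, d) -> d = 0) -> G (b, c) -> G (b, d) -> c = d.
Proof.
move=> subG Gf Gc Gd; apply/subr0_eq/Gf.
by have := submoduleB subG Gc Gd; rewrite /= -[(_, _) - _]/(b - b, c - d) subrr.
Qed.

Lemma graph_linear B I (G : set (B * I)%type) : submodule G ->
    (forall d, G (0, d) -> d = 0) -> (forall b, exists d, G (b, d)) ->
  exists h : {linear B -> I}, forall b, G (b, h b).
Proof.
move=> subG Gf /choice[h Gh].
have hlin : linear h.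
  move=> a x y; apply: (graph_uniq subG Gf) (Gh _) _.
  by case: subG => _ /(_ a _ _ (Gh x) (Gh y)).
by exists (to_linear hlin).
Qed.

(** A partial map is a map out of its graph, which embeds in the source by the
    first projection. *)
Lemma injective_extend B I (G : set (B * I)%type) : injective_module I ->
    submodule G -> (forall d, G (0, d) -> d = 0) ->
  exists h : {linear B -> I}, forall b d, G (b, d) -> h b = d.
Proof.
move=> Iinj subG Gf.
have p1 : linear (fun x : submod subG => (submod_val x).1) by [].
have p2 : linear (fun x : submod subG => (submod_val x).2) by [].
have p1_inj : injective (to_linear p1).
  move=> x y xy; apply: submod_inj; apply/eqP; rewrite -pair_eqE /pair_eq /=.
  apply/andP; split; apply/eqP => //.
  apply: (@graph_uniq _ _ G (submod_val x).1) => //.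
    by rewrite -surjective_pairing; apply: submod_in.
  rewrite [X in (X, _)](xy : _ = (submod_val y).1) -surjective_pairing.
  exact: submod_in.
have [h hE] := Iinj _ _ (to_linear p1) (to_linear p2) p1_inj.
by exists h => b d Gbd; have := hE (to_submod subG Gbd).
Qed.

End Graphs.

(** * Divisible abelian groups and Q/Z *)

Lemma int_submodule_principal (N : set int^o) : submodule N ->
  exists n : int, forall k, N k <-> (n %| k)%Z.
Proof.
move=> subN; have [N0 NP] := subN.
have NM (a k : int) : N k -> N (a * k) by move=> Nk; apply: (submoduleZ a subN Nk).
have [exN|noN] := pselect (exists m : nat, (0 < m)%N && `[< N m%:Z >]).
  have [n /andP[n_gt0 /asboolP Nn] n_min] := ex_minnP exN.
  have n_neq0 : n%:Z != 0 by rewrite -lt0n.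
  exists n => k; split=> [Nk|/dvdzP[q ->]]; last exact: NM.
  apply/dvdz_mod0P.
  have : N (k %% n)%Z.
    by rewrite /modz -mulNr addrC; apply: NP (- (k %/ n)%Z) _ _ Nn Nk.
  have := ltz_mod k n_neq0; have := modz_ge0 k n_neq0.
  case: (k %% n)%Z => // m _ /= mn Nm; case: (posnP m) => [->//|m_gt0].
  have := n_min m; rewrite m_gt0 (asboolT Nm) leqNgt => /(_ isT).
  by rewrite -ltz_nat mn.
exists 0 => k; rewrite dvd0z; split=> [Nk|/eqP-> //].
apply: contra_notT noN => k_neq0; exists `|k|%N; rewrite absz_gt0 k_neq0.
by apply/asboolP; rewrite abszEsign; apply: NM.
Qed.

(** Baer's argument.  A maximal graph G extending the given map is total: the
    integers k with k b in the domain of G are the multiples of some n, and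
    dividing the value at n b by n gives a compatible value at b. *)
Lemma divisible_injective (D : lmodType int) :
  (forall (n : int) (d : D), n != 0 -> exists e, n *: e = d) -> injective_module D.
Proof.
move=> Ddiv A B i g i_inj.
pose G0 : set (B * D)%type := [set (i a, g a) | a in [set: A]].
have subG0 : submodule G0.
  split; first by exists 0; rewrite // !linear0.
  by move=> a _ _ [x _ <-] [y _ <-]; exists (a *: x + y); rewrite // !linearP.
pose Q : set (B * D)%type := [set p | p.1 = 0 -> p.2 = 0].
have G0Q : G0 `<=` Q.
  move=> _ [a _ <-]; rewrite /Q /= => ia0.
  suff -> : a = 0 by rewrite linear0.
  by apply: i_inj; rewrite ia0 linear0.
have [G [subG G0G GQ Gmax]] := max_submodule subG0 G0Q.
have Gf d : G (0, d) -> d = 0 by move=> /GQ; apply.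
have Gtot b : exists d, G (b, d).
  pose dom : set int^o := [set k | exists d, G (k *: b, d)].
  have sub_dom : submodule dom.
    split; first by exists 0; rewrite scale0r; case: subG.
    move=> a x y [c Gc] [d Gd]; exists (a *: c + d).
    by case: subG => _ /(_ a _ _ Gc Gd); rewrite scalerDl -scalerA.
  have [n domE] := int_submodule_principal sub_dom.
  have [e eP] : exists e, forall k d, G (k *: b, d) -> d = k *: e.
    have [d0 Gd0] : dom n by apply/domE.
    have [n0|n_neq0] := eqVneq n 0.
      exists 0 => k d Gd; have /domE : dom k by exists d.
      rewrite n0 dvd0z => /eqP k0; rewrite scaler0; apply: Gf.
      by move: Gd; rewrite k0 scale0r.
    have [e ne] := Ddiv n d0 n_neq0; exists e => k d Gd.
    have /domE/dvdzP[l kE] : dom k by exists d.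
    apply: (graph_uniq subG Gf Gd); rewrite kE -!scalerA ne.
    exact: (submoduleZ l subG Gd0).
  exists e; apply: Gmax => -[x d] a Gx /= xab.
  have /eP : G (- a *: b, d).
    by rewrite scaleNr; move/eqP: xab; rewrite addr_eq0 => /eqP <-.
  by move=> -> /=; rewrite scaleNr addNr.
have [h hG] := graph_linear subG Gf Gtot; exists h => a.
by apply: (graph_uniq subG Gf (hG _)); apply: G0G; exists a.
Qed.

Lemma additive_intZ (U V : lmodType int) (f : U -> V) :
  {morph f : x y / x + y} -> forall (n : int) x, f (n *: x) = n *: f x.
Proof.
move=> fD; have f0 : f 0 = 0 by apply: (addIr (f 0)); rewrite -fD !add0r.
have fB : zmod_morphism f.
  move=> x y; rewrite fD; congr (_ + _); apply: (addIr (f y)).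
  by rewrite -fD !addNr.
pose F : {additive U -> V} := HB.pack f (GRing.isZmodMorphism.Build U V f fB).
by move=> n x; rewrite -[n]intz !scaler_int; apply: (raddfMz F).
Qed.

Definition integers_in_rat := GRing.ZmodClosed.clone rat (@Num.int_num_subdef rat) _.

(** The group Q/Z. *)
Definition rat_mod_int : lmodType int := zmodule (Quotient.quot integers_in_rat).

Definition rat_class (q : rat) : rat_mod_int :=
  \pi_(Quotient.quot integers_in_rat)%qT q.

Lemma rat_classD : {morph rat_class : p q / p + q}.
Proof. exact: (Quotient.pi_add integers_in_rat). Qed.

Lemma rat_classZ (k : int) q : rat_class (k%:~R * q) = k *: rat_class q.
Proof.
by rewrite mulrzl -[RHS](@additive_intZ (zmodule rat) _ _ rat_classD).
Qed.

Lemma rat_class_eq0 q : rat_class q = 0 <-> q \is a Num.int.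
Proof.
have := Quotient.idealrBE integers_in_rat q 0; rewrite subr0.
have -> : \pi_(Quotient.quot integers_in_rat)%qT 0 = rat_class 0 by [].
have -> : rat_class 0 = 0 by rewrite -(mulr0 0%:~R) rat_classZ scale0r.
move=> qE; split=> [q0|]; first by have := qE; rewrite -/(rat_class q) q0 eqxx.
by move=> q_int; apply/eqP; have := qE; rewrite q_int => <-.
Qed.

Lemma rat_class_surj d : exists q, d = rat_class q.
Proof. by exists (repr d); rewrite /rat_class reprK. Qed.

Lemma rat_mod_int_injective : injective_module rat_mod_int.
Proof.
apply: divisible_injective => n d n_neq0; have [q ->] := rat_class_surj d.
exists (rat_class (q / n%:~R)); rewrite -rat_classZ mulrC divfK //.
by rewrite intr_eq0.
Qed.

(** A map killing N and sending v to a nonzero q exists on N + Z v as soon as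
    every integer k with k v in N satisfies k q = 0.  These k are the multiples
    of some n <> 1, so the class of 1/n serves if n <> 0, and any nonzero q if
    n = 0. *)
Lemma rat_mod_int_cogenerates (V : lmodType int) (N : set V) (v : V) :
  submodule N -> ~ N v ->
  exists2 phi : {linear V -> rat_mod_int}, (forall x, N x -> phi x = 0) & phi v <> 0.
Proof.
move=> subN Nv.
have sub_ann : submodule ([set k | N (k *: v)] : set int^o).
  split; first by rewrite /= scale0r; case: subN.
  by move=> a k l /= Nk Nl; rewrite scalerDl -scalerA; case: subN => _; apply.
have [n annE] := int_submodule_principal sub_ann.
have [q q_neq0 qP] : exists2 q, rat_class q <> 0 &
    forall k, N (k *: v) -> k *: rat_class q = 0.
  have [n0|n_neq0] := eqVneq n 0.
    exists (1 / 2)%Q; first by move/rat_class_eq0.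
    by move=> k /annE; rewrite n0 dvd0z => /eqP ->; rewrite scale0r.
  exists (n%:~R^-1).
    move=> /rat_class_eq0/intrP[m nm]; apply: Nv; rewrite -[v]scale1r; apply/annE.
    apply/dvdzP; exists m; apply: (@intr_inj rat).
    by rewrite intrM -nm mulVf ?intr_eq0.
  move=> k /annE/dvdzP[l ->]; rewrite -rat_classZ; apply/rat_class_eq0.
  by rewrite intrM mulfK ?intr_eq0 // intr_int.
pose G : set (V * rat_mod_int)%type :=
  [set (x + k *: v, k *: rat_class q) | x in N & k in [set: int]].
have [||phi phiG] := injective_extend (G := G) rat_mod_int_injective.
- split; first by exists 0; [case: subN | exists 0; rewrite // !scale0r addr0].
  move=> a _ _ [x Nx [k _ <-]] [y Ny [l _ <-]].
  exists (a *: x + y); first by case: subN => _; apply.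
  exists (a * k + l) => //; rewrite scalerDl -scalerA addrACA -scalerDr.
  by rewrite scalerDl -scalerA.
- move=> d [x Nx [k _ [xk <-]]]; apply: qP.
  suff -> : k *: v = - x by rewrite -scaleN1r; apply: submoduleZ.
  by apply/eqP; rewrite -addr_eq0 addrC xk.
exists phi.
  move=> x Nx; apply: phiG; exists x => //.
  by exists 0; rewrite // !scale0r addr0.
suff -> : phi v = rat_class q by [].
apply: phiG; exists 0; first by case: subN.
by exists 1; rewrite // !scale1r add0r.
Qed.

(** * Enough injective modules *)

Lemma injective_power (R : pzRingType) (K : Type) (I : lmodType R) :
  injective_module I -> injective_module (K -> I).
Proof.
move=> I_inj A B i g i_inj.
have g_lin k : linear (fun a => g a k) by move=> a x y; rewrite linearP.
have /choice[h hE] k : exists h : {linear B -> I}, forall a, h (i a) = g a k.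
  by have [h hE] := I_inj _ _ i (to_linear (g_lin k)) i_inj; exists h.
have h_lin : linear (fun b k => h k b).
  by move=> a x y; apply/funext => k; rewrite linearP.
by exists (to_linear h_lin) => a; apply/funext => k; apply: hE.
Qed.

Lemma injective_prod (R : pzRingType) (I J : lmodType R) :
  injective_module I -> injective_module J -> injective_module (I * J)%type.
Proof.
move=> I_inj J_inj A B i g i_inj.
have g1 : linear (fun a => (g a).1) by move=> a x y; rewrite linearP.
have g2 : linear (fun a => (g a).2) by move=> a x y; rewrite linearP.
have [h1 h1E] := I_inj _ _ i (to_linear g1) i_inj.
have [h2 h2E] := J_inj _ _ i (to_linear g2) i_inj.
have h_lin : linear (fun b => (h1 b, h2 b)) by move=> a x y; rewrite !linearP.
by exists (to_linear h_lin) => a; rewrite /= h1E h2E -surjective_pairing.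
Qed.

Section Coinduced.
Variables (R : pzRingType) (D : lmodType int).

(** The module Hom_Z(R, D), where a in R acts by right multiplication on the
    argument. *)
Record coind : Type := Coind {
  coind_fun :> R -> D;
  coindD : {morph coind_fun : r s / r + s} }.

HB.instance Definition _ := gen_eqMixin coind.
HB.instance Definition _ := gen_choiceMixin coind.

Lemma coind_ext (f g : coind) : f =1 g -> f = g.
Proof.
case: f g => [f fD] [g gD] /= /funext fg.
by subst g; congr Coind; apply: Prop_irrelevance.
Qed.

Definition coind_zero : coind.
Proof. by exists (fun=> 0) => r s; rewrite addr0. Defined.

Definition coind_opp (f : coind) : coind.
Proof. by exists (fun r => - f r) => r s; rewrite coindD opprD. Defined.

Definition coind_add (f g : coind) : coind.
Proof. by exists (fun r => f r + g r) => r s; rewrite !coindD addrACA. Defined.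

Definition coind_scale (a : R) (f : coind) : coind.
Proof. by exists (fun r => f (r * a)) => r s; rewrite mulrDl coindD. Defined.

Fact coind_addA : associative coind_add.
Proof. by move=> f g h; apply: coind_ext => r; apply: addrA. Qed.

Fact coind_addC : commutative coind_add.
Proof. by move=> f g; apply: coind_ext => r; apply: addrC. Qed.

Fact coind_add0 : left_id coind_zero coind_add.
Proof. by move=> f; apply: coind_ext => r; apply: add0r. Qed.

Fact coind_addN : left_inverse coind_zero coind_opp coind_add.
Proof. by move=> f; apply: coind_ext => r; apply: addNr. Qed.

HB.instance Definition _ := GRing.isZmodule.Build coind
  coind_addA coind_addC coind_add0 coind_addN.

Fact coind_scaleA a b (f : coind) :
  coind_scale a (coind_scale b f) = coind_scale (a * b) f.
Proof. by apply: coind_ext => r /=; rewrite mulrA. Qed.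

Fact coind_scale1 : left_id 1 coind_scale.
Proof. by move=> f; apply: coind_ext => r /=; rewrite mulr1. Qed.

Fact coind_scaleDr : right_distributive coind_scale +%R.
Proof. by move=> a f g; apply: coind_ext. Qed.

Fact coind_scaleDl (f : coind) :
  {morph coind_scale^~ f : a b / a + b >-> a + b}.
Proof. by move=> a b; apply: coind_ext => r /=; rewrite mulrDr coindD. Qed.

HB.instance Definition _ := GRing.Zmodule_isLmodule.Build R coind
  coind_scaleA coind_scale1 coind_scaleDr coind_scaleDl.

(** By adjunction, R-linear maps to Hom_Z(R, D) are additive maps to D:
    evaluate at 1 in one direction, send k to b |-> (r |-> k (r b)) in the
    other. *)
Lemma injective_coind : injective_module D -> injective_module coind.
Proof.
move=> D_inj A B i g i_inj.
have iD : {morph (i : zmodule A -> zmodule B) : x y / x + y}.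
  by move=> x y; apply: linearD.
have i_lin : linear (i : zmodule A -> zmodule B).
  by move=> n x y; rewrite iD (additive_intZ iD).
have gD : {morph ((fun a => g a 1) : zmodule A -> D) : x y / x + y}.
  by move=> x y; rewrite linearD.
have g_lin : linear ((fun a => g a 1) : zmodule A -> D).
  by move=> n x y; rewrite gD (additive_intZ gD).
have [k kE] := D_inj _ _ (to_linear i_lin) (to_linear g_lin) i_inj.
have hD (b : B) : {morph (fun r : R => k (r *: b)) : r s / r + s}.
  by move=> r s; rewrite scalerDl; apply: (linearD k).
have h_lin : linear (fun b => Coind (hD b)).
  move=> a x y; apply: coind_ext => r /=.
  by rewrite scalerDr scalerA; apply: (linearD k).
exists (to_linear h_lin) => a; apply: coind_ext => r /=.
have := kE (r *: a); rewrite /= !linearZ => ->.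
by rewrite /= -[RHS]/(g a r) -[LHS]/(g a (1 * r)) mul1r.
Qed.

End Coinduced.

(** Send m to r |-> (phi |-> phi (r m)), where phi ranges over the additive
    maps from M to Q/Z that vanish on N; evaluation at r = 1 shows that nothing
    outside N is killed. *)
Lemma injective_with_kernel (R : pzRingType) (M : lmodType R) (N : set M) :
  submodule N ->
  exists (J : lmodType R) (f : {linear M -> J}),
    injective_module J /\ forall x, f x = 0 <-> N x.
Proof.
move=> subN.
pose K := {phi : {linear zmodule M -> rat_mod_int} | forall x, N x -> phi x = 0}.
pose J : lmodType R := coind R (K -> rat_mod_int).
have fD m : {morph (fun (r : R) (phi : K) => sval phi (r *: m)) : r s / r + s}.
  move=> r s; apply/funext => phi; rewrite scalerDl.
  exact: (linearD (sval phi)).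
have f_lin : linear ((fun m => Coind (fD m)) : M -> J).
  move=> a x y; apply: coind_ext => r; apply/funext => phi /=.
  by rewrite scalerDr scalerA; apply: (linearD (sval phi)).
exists J, (to_linear f_lin); split.
  exact/injective_coind/injective_power/rat_mod_int_injective.
move=> x; split=> [/(congr1 (fun h : J => h 1)) fx0|Nx]; last first.
  apply: coind_ext => r; apply/funext => phi /=.
  by apply: (svalP phi); apply: submoduleZ.
apply: contrapT => Nx.
have subN' : submodule (N : set (zmodule M)).
  split; first by case: subN.
  move=> n y z Ny Nz; apply: (submoduleD subN) => //.
  by rewrite scalezrE -scaler_int; apply: submoduleZ.
have [phi phiN] := rat_mod_int_cogenerates subN' Nx; apply.
have /= := congr1 (fun h : K -> rat_mod_int => h (exist _ phi phiN)) fx0.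
by rewrite scale1r.
Qed.

(** * Injective hulls *)

Lemma injective_retract (R : pzRingType) (I P : lmodType R)
    (s : {linear I -> P}) (r : {linear P -> I}) :
  cancel s r -> injective_module P -> injective_module I.
Proof.
move=> sK P_inj A B i g i_inj.
have [h hE] := P_inj _ _ i (s \o g) i_inj.
by exists (r \o h) => a; rewrite /= hE /= sK.
Qed.

Lemma injective_split_mono (R : pzRingType) (I V : lmodType R)
  (f : {linear I -> V}) : injective_module I -> injective f -> split_mono f.
Proof. by move=> I_inj f_inj; have [g gf] := I_inj _ _ f idfun f_inj; exists g. Qed.

Definition essential (R : pzRingType) (V : lmodType R) (S E : set V) : Prop :=
  forall x, E x -> x <> 0 -> exists a, S (a *: x) /\ a *: x <> 0.

(** Take E maximal among the submodules of P in which S is essential, and K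
    maximal among the submodules meeting E trivially.  The projection of E + K
    onto E extends to an endomorphism g of P.  By maximality of K, every g p <> 0
    has a nonzero multiple in E; hence S is essential in E + g(P), and maximality
    of E gives g(P) = E.  So g retracts P onto E. *)
Lemma injective_hull (R : pzRingType) (P : lmodType R) (S : set P) :
  injective_module P -> submodule S ->
  exists (E : set P) (subE : submodule E),
    [/\ S `<=` E, essential S E & injective_module (submod subE)].
Proof.
move=> P_inj subS.
pose Q : set P := [set x | x <> 0 -> exists a, S (a *: x) /\ a *: x <> 0].
have SQ : S `<=` Q by move=> x Sx x0; exists 1; rewrite scale1r.
have [E [subE SE EQ Emax]] := max_submodule subS SQ.
have [|K [subK _ KE Kmax]] := @max_submodule _ P _ [set x | E x -> x = 0] (submodule0 P).
  by move=> x ->.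
pose G : set (P * P)%type := [set (e + k, e) | e in E & k in K].
have [||g gE] := injective_extend (G := G) P_inj.
- split; first by exists 0; [case: subE | exists 0; rewrite ?addr0 //; case: subK].
  move=> a _ _ [e Ee [k Kk <-]] [e' Ee' [k' Kk' <-]].
  exists (a *: e + e'); first by case: subE => _; apply.
  exists (a *: k + k'); first by case: subK => _; apply.
  by rewrite addrACA -scalerDr.
- move=> _ [e Ee [k Kk [ek <-]]]; apply: KE => //.
  have -> : e = - k by apply/eqP; rewrite -addr_eq0 ek.
  by rewrite -scaleN1r; apply: submoduleZ.
have g_id e : E e -> g e = e.
  by move=> Ee; apply: gE; exists e => //; exists 0; rewrite ?addr0 //; case: subK.
have g_ker k : K k -> g k = 0.
  by move=> Kk; apply: gE; exists 0; [case: subE | exists k; rewrite ?add0r].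
have gQ w : Q (g w).
  move=> gw_neq0.
  have [y [b [Ky Eyw yw_neq0]]] : exists y b,
      [/\ K y, E (y + b *: w) & y + b *: w <> 0].
    apply: contrapT => noyb; apply/gw_neq0/g_ker/Kmax => y b Ky Eyw.
    by apply: contrapT => yw_neq0; apply: noyb; exists y, b.
  have [c] := EQ _ Eyw yw_neq0.
  have <- : g (y + b *: w) = y + b *: w by apply: g_id.
  by rewrite linearD linearZ /= g_ker // add0r scalerA; exists (c * b).
have gP p : E (g p).
  apply: Emax => x a Ex; rewrite -[x in x + _]g_id // -linearZ -linearD.
  exact: gQ.
have r_lin : linear (fun p => to_submod subE (gP p)).
  by move=> a x y; apply: submod_inj; apply: (linearP g).
exists E, subE; split=> //.
apply: (injective_retract (s := to_linear (@submod_linear _ _ _ subE))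
                          (r := to_linear r_lin)) P_inj.
by move=> x; apply: submod_inj; exact: g_id (submod_in x).
Qed.

(** * The shift on the injective hull of a countable direct sum *)

Section Shift.
Variables (R : pzRingType) (J : lmodType R).

Definition scons (j : J) (s : nat -> J) : nat -> J :=
  fun i => if i is i'.+1 then s i' else j.

Definition finitely_supported : set (nat -> J) :=
  [set s | exists N, forall i, (N <= i)%N -> s i = 0].

Lemma finitely_supported_submodule : submodule finitely_supported.
Proof.
split; first by exists 0.
move=> a s t [m sm] [n tn]; exists (maxn m n) => i; rewrite geq_max => /andP[mi ni].
by rewrite -[LHS]/(a *: s i + t i) sm // tn // scaler0 addr0.
Qed.

Lemma scons_linear a j k s t :
  scons (a *: j + k) (a *: s + t) = a *: scons j s + scons k t.
Proof. by apply/funext => -[]. Qed.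

Lemma scons_finitely_supported j s :
  finitely_supported (scons j s) <-> finitely_supported s.
Proof.
split=> -[N sN]; first by exists N => i Ni; apply: (sN i.+1); apply: leqW.
by exists N.+1 => -[//|i] Ni; apply: sN.
Qed.

(** The module E is a hull of the sequences of finite support inside J^nat, and
    tau extends the shift (j, s) |-> scons j s.  The last clause says that an
    element of E cannot be infinitely often of the form tau (c, _), as the
    constant sequence c would be, unless it vanishes. *)
Lemma injective_shift : injective_module J ->
  exists (E : lmodType R) (tau : {linear (J * E)%type -> E}),
    [/\ injective_module E, injective tau &
      forall (c : J) (u : nat -> E), (forall n, u n = tau (c, u n.+1)) ->
        u 0 = 0].
Proof.
move=> J_inj; pose S := finitely_supported.
have subS : submodule S := finitely_supported_submodule.
have P_inj : injective_module (nat -> J) by apply: injective_power.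
have [E0 [subE [SE Eess E_inj]]] := injective_hull P_inj subS.
pose E := submod subE.
pose G : set ((J * E) * E)%type :=
  [set p | S (submod_val p.1.2) /\ submod_val p.2 = scons p.1.1 (submod_val p.1.2)].
have [||tau tauE] := injective_extend (G := G) E_inj.
- split; first by split; [case: subS | apply/funext => -[]].
  move=> a [[j e] d] [[j' e'] d'] [/= Se dE] [/= Se' dE'].
  have valP (x y : E) : submod_val (a *: x + y) = a *: submod_val x + submod_val y.
    exact: submod_linear.
  have Se'' : S (submod_val (a *: e + e')) by rewrite valP; apply: subS.2.
  split; first exact: Se''.
  apply: (etrans (valP d d')); rewrite dE dE' -scons_linear -valP.
  reflexivity.
- by move=> d [_ dE]; apply: submod_inj; rewrite dE; apply/funext => -[].
have tau_scons j e e' : S (submod_val e) ->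
    submod_val e' = scons j (submod_val e) -> tau (j, e) = e'.
  by move=> Se e'E; apply: tauE.
pose emb s (Ss : S s) : E := to_submod subE (SE _ Ss).
have tau_ker0 j e : S (submod_val e) -> tau (j, e) = 0 -> submod_val e = 0 /\ j = 0.
  move=> Se; have Sje : S (scons j (submod_val e)) by apply/scons_finitely_supported.
  rewrite (tau_scons j e (emb _ Sje) Se erefl).
  move=> /(congr1 (@submod_val _ _ _ _)) /= je0.
  by split; [apply/funext => i; apply: (congr1 (fun s => s i.+1) je0) |
             apply: (congr1 (fun s => s 0%N) je0)].
have tauZ a j (e : E) : tau (a *: j, a *: e) = a *: tau (j, e) by rewrite -linearZ.
(* If tau (j, e) = 0 and e <> 0, a multiple (a j, a e) with a e <> 0 in S is still
   in the kernel; but there tau is the shift. *)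
have tau_inj : injective tau.
  suff ker_tau p : tau p = 0 -> p = 0.
    by move=> p q pq; apply/subr0_eq/ker_tau; rewrite linearB pq subrr.
  case: p => j e taup0.
  have [e0|e_neq0] := pselect (submod_val e = 0).
    have [|_ ->] := tau_ker0 _ _ _ taup0; first by rewrite e0; case: subS.
    by congr pair; apply: submod_inj.
  have [a [Sae []]] := Eess _ (submod_in e) e_neq0.
  have tau0 : tau (a *: j, a *: e) = 0 by rewrite tauZ taup0 scaler0.
  by have [] := tau_ker0 (a *: j) (a *: e) Sae tau0.
exists E, tau; split=> // c u uE.
apply: contrapT => u0_neq0.
have u0v_neq0 : submod_val (u 0%N) <> 0 by move=> u00; apply/u0_neq0/submod_inj.
have [a [Sau au_neq0]] := Eess _ (submod_in (u 0%N)) u0v_neq0.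
pose s := a *: submod_val (u 0%N).
(* By injectivity of tau, a *: u n is s with its first n coordinates removed. *)
have us n : submod_val (a *: u n) = (fun i => s (n + i)%N) /\
    S (fun i => s (n + i)%N).
  elim: n => [//|n [auE Sn]].
  have sE : (fun i => s (n + i)%N) = scons (s n) (fun i => s (n.+1 + i)%N).
    by apply/funext => -[|i] /=; rewrite ?addn0 // addnS.
  have Sn1 : S (fun i => s (n.+1 + i)%N).
    by apply/(@scons_finitely_supported (s n)); rewrite -sE.
  split=> //.
  have : tau (s n, emb _ Sn1) = tau (a *: c, a *: u n.+1).
    by rewrite tauZ -uE; apply: tau_scons; rewrite ?auE.
  move=> /tau_inj/(congr1 snd) /= ue.
  exact: (congr1 (@submod_val _ _ _ _) (esym ue)).
(* Comparing the removed coordinates shows that s is constant. *)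
have s_const n : s n = a *: c.
  have [auE Sn] := us n; have [_ Sn1] := us n.+1.
  have : tau (s n, emb _ Sn1) = tau (a *: c, a *: u n.+1).
    rewrite tauZ -uE; apply: tau_scons => //; rewrite auE.
    by apply/funext => -[|i] /=; rewrite ?addn0 // addnS.
  by move=> /tau_inj/(congr1 fst).
have [N sN] := Sau.
by apply: au_neq0; apply/funext => i; rewrite -/s s_const -(s_const N); apply: sN.
Qed.

End Shift.

(** * The tower of iterates *)

Lemma inj_surj_bijective (T U : Type) (f : T -> U) :
  injective f -> (forall y, exists x, f x = y) -> bijective f.
Proof.
move=> f_inj /choice[g gK]; exists g => // x.
by apply: f_inj; rewrite gK.
Qed.

(** The entry 0 of a thread determines the others, since sigma is injective, and
    it lies in every image; conversely the preimages of y under the iterates of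
    sigma form a thread. *)
Lemma tower_lim_iter_cap (R : pzRingType) (I : lmodType R)
    (sigma : {linear I -> I}) :
  injective sigma ->
  lmod_iso (tower_lim (fun=> I) (fun=> sigma)) (iter_cap sigma).
Proof.
move=> sigma_inj; pose L := tower_lim (fun=> I) (fun=> sigma).
have iterP (x : L) n k : iter n sigma (x (n + k)%N) = x k.
  by elim: n k => // n IH k; rewrite iterSr addSn threadP.
have capP (x : L) : x 0%N \in iter_image_cap_pred sigma.
  by apply/mem_set => n _; exists (x n) => //; rewrite -[RHS](iterP x n) addn0.
have f_lin : linear (fun x => IterCap (capP x)) by move=> a x y; apply: val_inj.
have iter_inj n : injective (iter n sigma).
  by elim: n => // n IH x y /sigma_inj/IH.
exists (to_linear f_lin); apply: inj_surj_bijective.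
  move=> x y /(congr1 val) /= xy0; apply: tower_lim_ext => n.
  apply: (iter_inj n); have := iterP x n 0%N; have := iterP y n 0%N.
  by rewrite addn0 => -> ->.
move=> y; have y_in := set_mem (valP y : val y \in iter_image_cap sigma).
have /choice[u uE] n : exists u, iter n sigma u = val y.
  by have [u _ uE] := y_in n Logic.I; exists u.
have uP n : sigma (u n.+1) = u n.
  by apply: (iter_inj n); rewrite -iterSr !uE.
exists (TowerLim (X := fun=> I) (f := fun=> sigma) uP).
by apply: val_inj; apply: (uE 0%N).
Qed.

Theorem theoremB (R : pzRingType) (M : lmodType R) :
  exists (I : lmodType R) (sigma : {linear I -> I}),
    [/\ injective_module I,
        split_mono sigma,
        lmod_iso M (tower_lim (fun=> I) (fun=> sigma))
      & lmod_iso (tower_lim (fun=> I) (fun=> sigma))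
                 (iter_cap sigma)].
Proof.
have [I0 [i [I0_inj i_ker]]] := injective_with_kernel (submodule0 M).
have sub_im : submodule (range i).
  split; first by exists 0; rewrite ?linear0.
  by move=> a _ _ [x _ <-] [y _ <-]; exists (a *: x + y); rewrite ?linearP.
have [J [f [J_inj f_ker]]] := injective_with_kernel sub_im.
have [E [tau [E_inj tau_inj tau_thread]]] := injective_shift J_inj.
have sigma_lin : linear (fun p : (I0 * E)%type => (p.1, tau (f p.1, p.2))).
  move=> a p q; rewrite /= linearP.
  by rewrite -[(_, _ + _)]/(a *: (f p.1, p.2) + (f q.1, q.2)) linearP.
pose sigma := to_linear sigma_lin.
have I_inj := injective_prod I0_inj E_inj.
have sigma_inj : injective sigma.
  by move=> [x d] [y e] [-> /tau_inj[->]].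
exists (I0 * E)%type, sigma; split=> //.
- exact: injective_split_mono.
- have fi m : f (i m) = 0 by apply/f_ker; exists m.
  have fixed m : sigma (i m, 0) = (i m, 0) by rewrite /= fi linear0.
  have h_lin : linear (fun m =>
      TowerLim (X := fun=> (I0 * E)%type) (f := fun=> sigma) (fun=> fixed m)).
    move=> a x y; apply: tower_lim_ext => n /=.
    by congr pair; rewrite /= ?linearP ?scaler0 ?addr0.
  exists (to_linear h_lin); apply: inj_surj_bijective.
    move=> x y /(congr1 (fun t => (thread t 0%N).1)) /= ixy.
    by apply/subr0_eq/i_ker; rewrite linearB ixy subrr.
  move=> x.
  have x1 n : (x n).1 = (x 0%N).1.
    by elim: n => // n <-; rewrite -[in RHS](threadP x n).
  have x2 n : (x n).2 = tau (f (x 0%N).1, (x n.+1).2).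
    by rewrite -[in LHS](threadP x n) /= x1.
  have x2_0 n : (x n).2 = 0.
    have := tau_thread (f (x 0%N).1) (fun k => (x (n + k)%N).2).
    by rewrite addn0; apply=> k; rewrite addnS.
  have /f_ker[m _ im] : f (x 0%N).1 = 0.
    have : tau (f (x 0%N).1, 0) = tau 0 by rewrite -{1}(x2_0 1%N) -x2 x2_0 linear0.
    by move=> /tau_inj/(congr1 fst).
  exists m; apply: tower_lim_ext => n /=.
  by rewrite [RHS]surjective_pairing x1 x2_0 im.
- exact: tower_lim_iter_cap.
Qed.
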